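(* Let $m\ge 1$ and $M\ge 0$ be integers and $N=M+m$. Let $-1\le x_0<x_1<\cdots<x_N\le 1$ and $-1\le y_0<y_1<\cdots<y_M\le 1$ be two sets of points, and let $\mathcal{L}_1,\ldots,\mathcal{L}_m$ be linear functionals (each $\mathcal{L}_i$ acting linearly on $(p,p',\ldots,p^{(m-1)})$) such that the Birkhoff-type interpolation problem described in the context has a unique solution for all data. Let $\mathbf{D}^{(m)}_{\mathbf{x}\mapsto\mathbf{y}}\in\mathbb{R}^{(M+1)\times(N+1)}$ be the rectangular $m$th-order differentiation matrix and $\mathbf{B}^{(-m)}_{\mathbf{y}\mapsto\mathbf{x}}\in\mathbb{R}^{(N+1)\times(N+1)}$ the $m$th-order pseudospectral integration matrix associated with these points and functionals, as defined in the context. Let $\mathbf{L}_m\in\mathbb{R}^{m\times(N+1)}$ be a matrix such that for every $p\in\mathbb{P}_N$, $$\begin{bmatrix}\mathcal{L}_1\left(p,\ldots,p^{(m-1)}\right)\\ \vdots\\ \mathcal{L}_m\left(p,\ldots,p^{(m-1)}\right)\end{bmatrix}=\mathbf{L}_m\begin{bmatrix}p(x_0)\\ \vdots\\ p(x_N)\end{bmatrix}.$$ Then $$\begin{bmatrix}\mathbf{D}^{(m)}_{\mathbf{x}\mapsto\mathbf{y}}\\ \mathbf{L}_m\end{bmatrix}\mathbf{B}^{(-m)}_{\mathbf{y}\mapsto\mathbf{x}}=\mathbf{I}_{N+1},$$ where $\mathbf{I}_{N+1}$ is the $(N+1)\times(N+1)$ identity matrix.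
   Context: $\mathbb{P}_n$ denotes the set of real algebraic polynomials of degree at most $n$. Matrix rows and columns are indexed starting from $0$. Rectangular differentiation matrix: let $\ell_{j,N}(x)=\prod_{n=0,\,n\ne j}^{N}\frac{x-x_n}{x_j-x_n}$, $j=0,\ldots,N$, be the Lagrange basis polynomials of degree $N$ for the points $\{x_j\}_{j=0}^N$. Then $\mathbf{D}^{(m)}_{\mathbf{x}\mapsto\mathbf{y}}=\left[\ell_{j,N}^{(m)}(y_i)\right]_{i=0,j=0}^{M,N}$, where $\ell_{j,N}^{(m)}$ is the $m$th derivative. Birkhoff-type interpolation problem: given real data $c_0,\ldots,c_{M+m}$, find $p\in\mathbb{P}_{M+m}$ such that $p^{(m)}(y_j)=c_j$ for $j=0,\ldots,M$ and $\mathcal{L}_i(p,\ldots,p^{(m-1)})=c_{M+i}$ for $i=1,\ldots,m$. When this problem is uniquely solvable for all data, its solution can be written as $p(x)=\sum_{j=0}^{M+m}c_jB_j(x)$ with polynomials $B_j\in\mathbb{P}_{M+m}$ not depending on the data; that is, $B_j$ is the solution for the data $c_k=\delta_{kj}$, $k=0,\ldots,M+m$. Pseudospectral integration matrix: with $N=M+m$, $\mathbf{B}^{(-m)}_{\mathbf{y}\mapsto\mathbf{x}}=\left[B_j(x_i)\right]_{i,j=0}^{N}$. *)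

(* Defs.v *)
From mathcomp Require Import all_boot all_order all_algebra.
From mathcomp Require Import boolp classical_sets reals.

Set Implicit Arguments.
Unset Strict Implicit.
Unset Printing Implicit Defensive.

Import Order.TTheory GRing.Theory Num.Theory.

Local Open Scope ring_scope.

Definition ordered_nodes (R : realType) (n : nat) (x : 'I_n -> R) : Prop :=
  (forall i, -1 <= x i <= 1) /\ {homo x : i j / (i < j)%N >-> i < j}.

(* P_n: degree at most n, where [size p] is the degree plus one *)
Definition deg_le (R : realType) (n : nat) (p : {poly R}) : Prop :=
  (size p <= n.+1)%N.

Definition lagrange_basis (R : realType) (n : nat) (x : 'I_n -> R)
    (j : 'I_n) : {poly R} :=
  \prod_(k < n | k != j) ((x j - x k)^-1 *: ('X - (x k)%:P)).

Definition diff_mx (R : realType) (m n k : nat) (x : 'I_n -> R)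
    (y : 'I_k -> R) : 'M[R]_(k, n) :=
  \matrix_(i, j) ((lagrange_basis x j)^`(m)).[y i].

(* (p, p', ..., p^(m-1)) *)
Definition jet (R : realType) (m : nat) (p : {poly R}) :
    {ffun 'I_m -> {poly R}} :=
  [ffun k : 'I_m => p^`(k)].

(* The index type 'I_(M.+1 + m) is that of 0, ..., M + m: [lshift m j] is the
   index j <= M and [rshift M.+1 i] is the index M + 1 + i, i.e. M + i' for
   the functional of one-based number i' = i + 1. *)
Definition birkhoff_solution (R : realType) (M m : nat) (y : 'I_M.+1 -> R)
    (L : 'I_m -> {scalar {ffun 'I_m -> {poly R}}})
    (c : 'I_(M.+1 + m) -> R) (p : {poly R}) : Prop :=
  [/\ deg_le (M + m) p,
      forall j : 'I_M.+1, (p^`(m)).[y j] = c (lshift m j)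
    & forall i : 'I_m, L i (jet m p) = c (rshift M.+1 i)].

Definition birkhoff_solvable (R : realType) (M m : nat) (y : 'I_M.+1 -> R)
    (L : 'I_m -> {scalar {ffun 'I_m -> {poly R}}}) : Prop :=
  forall c : 'I_(M.+1 + m) -> R, exists! p, birkhoff_solution y L c p.

(* [xget 0 A] is some element of A when A is nonempty and 0 otherwise; under
   [birkhoff_solvable y L] this is the unique solution for the data
   c_k = delta_kj. *)
Definition birkhoff_basis (R : realType) (M m : nat) (y : 'I_M.+1 -> R)
    (L : 'I_m -> {scalar {ffun 'I_m -> {poly R}}})
    (j : 'I_(M.+1 + m)) : {poly R} :=
  xget 0 [set p | birkhoff_solution y L (fun k => (k == j)%:R) p]%classic.

Definition integration_mx (R : realType) (M m : nat)
    (x : 'I_(M.+1 + m) -> R) (y : 'I_M.+1 -> R)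
    (L : 'I_m -> {scalar {ffun 'I_m -> {poly R}}}) : 'M[R]_(M.+1 + m) :=
  \matrix_(i, j) (birkhoff_basis y L j).[x i].

(* Main.v *)
(* The node values of p determine p by Lagrange interpolation, so D^(m) sends
   them to the values of p^(m) at y, while L_m sends them to the functionals of
   p.  For p = B_j, whose node values form column j of B^(-m), these are by
   construction the data c_k = delta_kj. *)
Require Import Defs.
From mathcomp Require Import all_boot all_order all_algebra.
From mathcomp Require Import boolp classical_sets reals.

Set Implicit Arguments.
Unset Strict Implicit.
Unset Printing Implicit Defensive.

Import Order.TTheory GRing.Theory Num.Theory.

Local Open Scope ring_scope.

(** At [x j] every factor is 1, injectivity keeping its denominator nonzero; at another node the
    factor [k = i] vanishes. *)
Lemma lagrange_basis_eval (R : realType) (n : nat) (x : 'I_n -> R)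
    (j i : 'I_n) :
  injective x -> (lagrange_basis x j).[x i] = (i == j)%:R.
Proof.
move=> x_inj; rewrite horner_prod; have [->|ij] := eqVneq i j.
  apply: big1 => k kj; rewrite !hornerE mulVf // subr_eq0.
  by rewrite (inj_eq x_inj) eq_sym.
by rewrite (bigD1 i) //= !hornerE subrr mulr0 mul0r.
Qed.

Lemma size_lagrange_basis (R : realType) (n : nat) (x : 'I_n -> R)
    (j : 'I_n) :
  (size (lagrange_basis x j) <= n)%N.
Proof.
rewrite /lagrange_basis scaler_prod; apply: leq_trans (size_scale_leq _ _) _.
(* There are [n.-1] monic linear factors, so the size is [n.-1.+1]; this is [n] because [j : 'I_n]
   forces [n] to be positive. *)
rewrite -big_filter size_prod_XsubC; have [e _ _ [_ ->]] := big_enumP.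
by rewrite cardC1 card_ord (ltn_predK (ltn_ord j)).
Qed.

(** The difference of the two sides has size at most [n] and vanishes at [n] distinct nodes, so it
    is zero. *)
Lemma lagrange_interpolation (R : realType) (n : nat) (x : 'I_n -> R)
    (p : {poly R}) :
  injective x -> (size p <= n)%N ->
  p = \sum_(j < n) p.[x j] *: lagrange_basis x j.
Proof.
move=> x_inj size_p; apply/eqP; rewrite -subr_eq0; apply/eqP.
apply: (@roots_geq_poly_eq0 _ _ [seq x i | i <- enum 'I_n]).
- apply/allP => _ /mapP[i _ ->]; rewrite rootE !hornerE horner_sum.
  rewrite (bigD1 i) //= big1 => [|j ji]; rewrite hornerZ lagrange_basis_eval //.
    by rewrite eqxx mulr1 addr0 subrr.
  by rewrite eq_sym (negPf ji) mulr0.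
- by rewrite map_inj_uniq // enum_uniq.
rewrite size_map size_enum_ord (leq_trans (size_polyD _ _)) //.
rewrite size_polyN geq_max size_p (leq_trans (size_sum _ _ _)) //.
apply/bigmax_leqP => j _; apply: leq_trans (size_scale_leq _ _) _.
exact: size_lagrange_basis.
Qed.

(** Differentiation is linear, so it acts termwise on the Lagrange expansion of [p]. *)
Lemma diff_mxP (R : realType) (m n k : nat) (x : 'I_n -> R) (y : 'I_k -> R)
    (p : {poly R}) :
  injective x -> (size p <= n)%N ->
  diff_mx m x y *m \col_i p.[x i] = \col_i (p^`(m)).[y i].
Proof.
move=> x_inj size_p; apply/matrixP => i z; rewrite !mxE.
rewrite [in RHS](lagrange_interpolation x_inj size_p) raddf_sum horner_sum.
by apply: eq_bigr => j _; rewrite !mxE /= derivnZ hornerZ mulrC.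
Qed.

Lemma ordered_nodes_inj (R : realType) (n : nat) (x : 'I_n -> R) :
  ordered_nodes x -> injective x.
Proof.
case=> _ x_lt i j xij; apply/val_inj/eqP; case: ltngtP => // /x_lt.
  by rewrite xij ltxx.
by rewrite xij ltxx.
Qed.

(** Solvability for the unit data makes the solution set nonempty, so [xget] returns a member of it
    and not the default [0]. *)
Lemma birkhoff_basisP (R : realType) (M m : nat) (y : 'I_M.+1 -> R)
    (L : 'I_m -> {scalar {ffun 'I_m -> {poly R}}}) (j : 'I_(M.+1 + m)) :
  birkhoff_solvable y L ->
  birkhoff_solution y L (fun k => (k == j)%:R) (birkhoff_basis y L j).
Proof.
by move=> /(_ (fun k => (k == j)%:R))[p [p_sol _]]; apply: (xgetI 0 p_sol).
Qed.

Theorem theorem3p1 (R : realType) (m M : nat) (m_ge1 : (1 <= m)%N)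
  (x : 'I_(M.+1 + m) -> R) (y : 'I_M.+1 -> R)
  (hx : ordered_nodes x) (hy : ordered_nodes y)
  (L : 'I_m -> {scalar {ffun 'I_m -> {poly R}}})
  (hL : birkhoff_solvable y L)
  (Lm : 'M[R]_(m, M.+1 + m))
  (hLm : forall p : {poly R}, deg_le (M + m) p ->
     \col_(i < m) L i (jet m p) = Lm *m \col_(i < M.+1 + m) p.[x i]) :
  col_mx (diff_mx m x y) Lm *m integration_mx x y L = 1%:M.
Proof.
have x_inj := ordered_nodes_inj hx.
apply/matrixP => i j; have [size_B derB LB] := birkhoff_basisP j hL.
set B := birkhoff_basis y L j in size_B derB LB.
have colB : col j (integration_mx x y L) = \col_k B.[x k].
  by apply/matrixP => k z; rewrite !mxE.
(* Column [j] of a product is the left factor times column [j] of the right one: [colE] turns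
   [col j] into a right multiplication, and associativity does the rest. *)
transitivity ((col_mx (diff_mx m x y) Lm *m \col_k B.[x k]) i 0).
  by rewrite -colB colE mulmxA -colE [RHS]mxE.
(* The bound in [size_B] fits [diff_mxP] since [(M + m).+1] and [M.+1 + m] are convertible.
   Splitting [i] then leaves [derB] for the upper block and [LB] for the lower one. *)
rewrite mul_col_mx diff_mxP // -hLm // [RHS]mxE -[i]splitK.
by case: (split i) => k /=; rewrite ?(col_mxEu, col_mxEd) mxE.
Qed.
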